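(* Let $\kappa>0$ and $\alpha\in(0,1)$, and let $g,y_0,y_+^*$ be as defined in the context. There exists $z_e>0$ (with $z_e\geqslant g(y_0)$, so that $y_+^*(z)$ is defined for all $z>z_e$) such that the following holds. Let $\beta$ satisfy $1>\beta>\alpha$, and let $f_0\in C^1(\mathbb{R},\mathbb{R})$ satisfy $$f_0(y)=\frac{\kappa(1+o_{y\to+\infty}(1))}{|y|^{\alpha}},\qquad f_0(y)=\frac{\kappa(1+o_{y\to-\infty}(1))}{|y|^{\beta}}$$ and $$f_0'(y)=\frac{-\alpha\kappa(1+o_{y\to+\infty}(1))}{y|y|^{\alpha}},\qquad f_0'(y)=\frac{-\beta\kappa(1+o_{y\to-\infty}(1))}{y|y|^{\beta}}.$$ Suppose also that $f_0>0$, that $f_0'>0$ on $(-\infty,0)$ and that $f_0'<0$ on $(0,+\infty)$. Let $f$ be the solution of the viscous Burgers equation $\partial_t f-\partial_x^2 f+f\,\partial_x f=0$ on $\mathbb{R}$ with initial data $f_0$. Then for any $z\in\mathbb{R}\setminus\{0,z_e\}$, $$t^{\frac{\alpha}{1+\alpha}}f\left(z\,t^{\frac{1}{1+\alpha}},t\right)\to\mathfrak{p}(z)\quad\text{as }t\to+\infty,$$ where $$\mathfrak{p}(z)=\begin{cases}\kappa|y_+^*(z)|^{-\alpha}&\text{if }z>z_e,\\ z&\text{if }0<z<z_e,\\ 0&\text{if }z<0.\end{cases}$$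
   Context: For $\kappa>0$, $\alpha\in(0,1)$, set $g(y)=y+\frac{\kappa}{|y|^{\alpha}}$ for $y\neq0$ and $y_0=(\kappa\alpha)^{\frac{1}{1+\alpha}}$. The function $y_+^*:(g(y_0),+\infty)\to(y_0,+\infty)$ is the inverse of the increasing bijection $g:(y_0,+\infty)\to(g(y_0),+\infty)$. The solution of the viscous Burgers equation with initial data $f_0$ is the one given by the Hopf-Cole formula: for $t>0$, $x\in\mathbb{R}$, $$f(x,t)=\frac{\int_{\mathbb{R}}\frac{x-y}{t}\exp\left(-\frac{(x-y)^2}{4t}-\frac12\int_0^y f_0(z)\,dz\right)dy}{\int_{\mathbb{R}}\exp\left(-\frac{(x-y)^2}{4t}-\frac12\int_0^y f_0(z)\,dz\right)dy}.$$ The notation $o_{y\to+\infty}(1)$ (resp. $o_{y\to-\infty}(1)$) denotes a function of $y$ tending to $0$ as $y\to+\infty$ (resp. $y\to-\infty$). *)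

(* Defs.v *)
From mathcomp Require Import all_boot all_order all_algebra.
From mathcomp Require Import all_classical all_reals all_analysis.
Import Order.TTheory GRing.Theory Num.Theory.
Import numFieldNormedType.Exports.

Set Implicit Arguments.
Unset Strict Implicit.
Unset Printing Implicit Defensive.

Local Open Scope classical_set_scope.
Local Open Scope ring_scope.

(* Only the values of [gfun] at y != 0 are meaningful. *)
Definition gfun {R : realType} (kappa alpha : R) (y : R) : R :=
  y + kappa / `|y| `^ alpha.

Definition y0 {R : realType} (kappa alpha : R) : R :=
  (kappa * alpha) `^ (1 + alpha)^-1.

(* The inverse of g : ]y0, +oo[ -> ]g(y0), +oo[; its value outside
   ]g(y0), +oo[ is the arbitrary default y0. *)
Definition yplus {R : realType} (kappa alpha : R) : R -> R :=
  'pinv_(fun=> y0 kappa alpha) `]y0 kappa alpha, +oo[ (gfun kappa alpha).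

Definition profile {R : realType} (kappa alpha z_e z : R) : R :=
  if z_e < z then kappa * `|yplus kappa alpha z| `^ (- alpha)
  else if 0 < z then z
  else 0.

(* u(y) = c (1 + o(1)) / w(y) along the filter F. *)
Definition quotient_asymp {R : realType} (F : set_system R)
    (u : R -> R) (c : R) (w : R -> R) : Prop :=
  exists2 o : R -> R, o y @[y --> F] --> (0 : R) &
    \forall y \near F, u y = c * (1 + o y) / w y.

(* The oriented integral of f over [0, y]: for y < 0 it is minus the integral
   over [y, 0]. *)
Definition integral0 {R : realType} (f : R -> R) (y : R) : R :=
  if 0 <= y then \int[lebesgue_measure]_(z in `[0, y]) f z
  else - \int[lebesgue_measure]_(z in `[y, 0]) f z.

Definition hopf_cole_weight {R : realType} (f0 : R -> R) (x t y : R) : R :=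
  expR (- ((x - y) ^+ 2 / (4 * t)) - 2^-1 * integral0 f0 y).

(* The solution at time t > 0 of the viscous Burgers equation with initial
   data f0. *)
Definition burgers_solution {R : realType} (f0 : R -> R) (x t : R) : R :=
  (\int[lebesgue_measure]_(y in setT)
      ((x - y) / t * hopf_cole_weight f0 x t y)) /
  (\int[lebesgue_measure]_(y in setT) hopf_cole_weight f0 x t y).

(* Main.v *)
Require Import Defs.
From mathcomp Require Import all_boot all_order all_algebra.
From mathcomp Require Import all_classical all_reals all_analysis.
From mathcomp Require Import measurable_realfun ring lra.

(** Set [s = t `^ (1 + alpha)^-1], [l = s `^ (1 - alpha) = s ^+ 2 / t], and use
    the variable [u = y / s].  At [x = z s] the Hopf-Cole weight is
    [expR (- l * Phi_s u)] with [Phi_s u = (z - u)^2 / 4 + F (s u) / (2 l)],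
    where [F] is the primitive of [f0] vanishing at 0, and the rescaled solution
    [t `^ (alpha / (1 + alpha)) * f (x, t)] is the average of [z - u] for this
    weight.  As [t] grows, [l] tends to infinity and [F (s u) / l] tends to
    [kappa / (1 - alpha) * u `^ (1 - alpha)] for [u > 0], and to 0 for [u <= 0]
    because [beta > alpha]; the error is at most a small multiple of [1 + `|u|]
    (lemma [rescaled_potential]).  By Laplace's method the average concentrates
    at the minimizer [u] of the limit phase, and the limit is [z - u].

    The rest is a study of the limit phase [Phi].  For [z < 0] its minimizer is
    [u = z].  For [z > 0] two points compete: [u = 0], where the phase has
    infinite slope on the right, and the solution of [g u = z] on the increasing branch of [g], since
    [Phi' u = (g u - z) / 2] for [u > 0].  From
    [Phi u - Phi 0 = u / 2 * (u / 2 + kappa / (1 - alpha) * u `^ (- alpha) - z)]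
    the second one wins exactly when [z] exceeds the minimum over [u > 0] of
    [u / 2 + kappa / (1 - alpha) * u `^ (- alpha)].  That minimum is [z_e]; it is
    attained at [shock_point], where it is also the value of [g].  When
    [g u = z] one has [z - u = kappa * u `^ (- alpha)], which is the announced
    profile.

    Laplace's method needs little here, because in each of the three cases
    [Phi] stays above [Phi u + c (w - u)^2] for all [w], with some [c > 0]
    (lemmas [phase_growth_neg], [phase_growth_small], [phase_growth_large]).
    These global bounds follow from the convexity of [u `^ (- alpha)] alone;
    they absorb the perturbation of the phase and dominate the weight by a
    Gaussian, without any compactness argument. *)

Import Order.TTheory GRing.Theory Num.Theory.
Import numFieldNormedType.Exports.
Local Open Scope classical_set_scope.
Local Open Scope ring_scope.

Set Implicit Arguments.
Unset Strict Implicit.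
Unset Printing Implicit Defensive.

(** * The limit phase *)

(** The convex function [u `^ (- a)] lies above its tangent at [v].  With
    [r = u / v] this is [expR (- a * ln r) >= 1 - a * ln r >= 1 - a * (r - 1)]. *)
Lemma powRN_ge_tangent (R : realType) (a u v : R) :
  0 <= a -> 0 < u -> 0 < v ->
  v `^ (- a) * (1 - a * (u / v - 1)) <= u `^ (- a).
Proof.
move=> a0 u0 v0; set r := u / v.
have r0 : 0 < r by rewrite divr_gt0.
have -> : u `^ (- a) = v `^ (- a) * r `^ (- a).
  by rewrite -powRM ?(ltW v0) ?(ltW r0)// /r mulrCA divff ?mulr1 ?gt_eqF.
rewrite ler_wpM2l ?powR_ge0//.
have lnr : ln r <= r - 1.
  by have := @le_ln1Dx R (r - 1); rewrite (addrC 1) subrK; apply; lra.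
have := expR_ge1Dx (- a * ln r).
rewrite /powR gt_eqF//; apply: le_trans.
by have := ler_wpM2l a0 lnr; lra.
Qed.

(** The primitive, vanishing at 0, of the limit of the rescaled initial datum:
    [kappa * u `^ (- alpha)] on the right and 0 on the left. *)
Definition potential {R : realType} (kappa alpha u : R) : R :=
  kappa / (1 - alpha) * (Num.max u 0) `^ (1 - alpha).

(** The rate function of the rescaled Hopf-Cole weight. *)
Definition phase {R : realType} (kappa alpha z u : R) : R :=
  (z - u) ^+ 2 / 4 + potential kappa alpha u / 2.

(** The abscissa where [steepness] equals [(1 - alpha) / 2]; it minimizes
    [u / 2 + kappa / (1 - alpha) * u `^ (- alpha)] over [u > 0]. *)
Definition shock_point {R : realType} (kappa alpha : R) : R :=
  (2 * kappa * alpha / (1 - alpha)) `^ (1 + alpha)^-1.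

(** The threshold [z_e]: the value of [z] for which 0 and [shock_point] are both
    minimizers of [phase kappa alpha z]. *)
Definition shock_speed {R : realType} (kappa alpha : R) : R :=
  gfun kappa alpha (shock_point kappa alpha).

(** Minus the derivative of [kappa * v `^ (- alpha)], so that
    [g' v = 1 - steepness v]. *)
Definition steepness {R : realType} (kappa alpha v : R) : R :=
  kappa * alpha * v `^ (- alpha) / v.

Section phase.
Variables (R : realType) (kappa alpha : R).
Hypotheses (kappa_gt0 : 0 < kappa) (alpha_gt0 : 0 < alpha) (alpha_lt1 : alpha < 1).

Local Notation g := (gfun kappa alpha).
Local Notation p := (potential kappa alpha).
Local Notation Phi := (phase kappa alpha).
Local Notation ue := (shock_point kappa alpha).
Local Notation ze := (shock_speed kappa alpha).
Local Notation y0 := (y0 kappa alpha).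
Local Notation q := (steepness kappa alpha).

Lemma gfunE u : 0 < u -> g u = u + kappa * u `^ (- alpha).
Proof. by move=> u0; rewrite /gfun gtr0_norm// powRN. Qed.

Lemma potential_le0 u : u <= 0 -> p u = 0.
Proof. by move=> u0; rewrite /potential max_r// powR0 ?mulr0// gt_eqF ?subr_gt0. Qed.

Lemma potential_gt0 u : 0 < u -> p u = kappa / (1 - alpha) * (u * u `^ (- alpha)).
Proof.
move=> u0; rewrite /potential max_l ?ltW//.
by rewrite powRD ?powRr1 ?ltW// (gt_eqF u0) implybT.
Qed.

Lemma potential_ge0 u : 0 <= p u.
Proof. by rewrite mulr_ge0 ?powR_ge0// divr_ge0 ?subr_ge0 ?ltW. Qed.

Lemma powRN_tangent u v : 0 < u -> 0 < v ->
  kappa * v `^ (- alpha) - q v * (u - v) <= kappa * u `^ (- alpha).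
Proof.
move=> u0 v0.
have := powRN_ge_tangent (ltW alpha_gt0) u0 v0.
rewrite -(ler_pM2l kappa_gt0); apply: le_trans.
by rewrite le_eqVlt /steepness; apply/orP; left; apply/eqP; field; rewrite gt_eqF.
Qed.

Lemma steepness_lt v w : 0 < w -> w < v -> q v < q w.
Proof.
move=> w0 wv; have v0 := lt_trans w0 wv.
have wa : 0 < w `^ alpha by rewrite powR_gt0.
have va : 0 < v `^ alpha by rewrite powR_gt0.
rewrite /steepness !powRN.
rewrite -!mulrA !ltr_pM2l//.
by rewrite -!invfM ltf_pV2 ?posrE ?mulr_gt0// ltr_pM ?ltW// gt0_ltr_powR ?nnegrE ?ltW.
Qed.

Lemma steepness_powR c : 0 < c -> q (c `^ (1 + alpha)^-1) = kappa * alpha / c.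
Proof.
move=> c0; set m := c `^ _; have m0 : 0 < m by exact: powR_gt0.
have mc : m * m `^ alpha = c.
  rewrite -[X in X * _]powRr1 ?(ltW m0)// -powRD ?(gt_eqF m0) ?implybT//.
  by rewrite -powRrM mulVf ?powRr1 ?ltW// gt_eqF ?addr_gt0.
by rewrite /steepness powRN -mulrA -invfM (mulrC _ m) mc.
Qed.

Lemma y0_gt0 : 0 < y0.
Proof. by rewrite powR_gt0// mulr_gt0. Qed.

Lemma steepness_y0 : q y0 = 1.
Proof. by rewrite steepness_powR ?divff ?gt_eqF ?mulr_gt0. Qed.

Lemma shock_point_gt0 : 0 < ue.
Proof. by rewrite powR_gt0// divr_gt0 ?mulr_gt0 ?subr_gt0. Qed.

Lemma steepness_shock_point : q ue = (1 - alpha) / 2.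
Proof.
rewrite steepness_powR ?divr_gt0 ?mulr_gt0 ?subr_gt0//.
by field; rewrite !gt_eqF ?subr_gt0.
Qed.

Lemma gfun_increasing a b : y0 < a -> a < b -> g a < g b.
Proof.
move=> ya ab; have a0 := lt_trans y0_gt0 ya; have b0 := lt_trans a0 ab.
have := powRN_tangent b0 a0; have := steepness_lt y0_gt0 ya.
rewrite steepness_y0 !gfunE// => q1 T.
have : q a * (b - a) < 1 * (b - a) by rewrite ltr_pM2r ?subr_gt0.
by lra.
Qed.

Lemma gfun_min u : 0 < u -> g y0 <= g u.
Proof.
move=> u0; have := powRN_tangent u0 y0_gt0.
rewrite steepness_y0 !gfunE ?y0_gt0//; lra.
Qed.

Lemma y0_lt_shock_point : y0 < ue.
Proof.
rewrite ltNge; apply/negP; rewrite le_eqVlt => /predU1P[e|].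
  by have := alpha_gt0; have := steepness_shock_point; rewrite e steepness_y0; lra.
move=> /(steepness_lt shock_point_gt0); rewrite steepness_shock_point steepness_y0.
by have := alpha_gt0; lra.
Qed.

Lemma shock_speed_gt0 : 0 < ze.
Proof.
rewrite /shock_speed gfunE ?shock_point_gt0// ltr_wpDr ?shock_point_gt0//.
by rewrite mulr_ge0 ?powR_ge0 ?ltW.
Qed.

Lemma steepnessM v : v != 0 -> q v * v = kappa * alpha * v `^ (- alpha).
Proof. by move=> v0; rewrite /steepness divfK. Qed.

(** The right-hand side is [2 (Phi u - Phi 0) / u + z], so this compares the
    phase at [u] and at 0.  By convexity it lies above its tangent at
    [shock_point], which is horizontal there. *)
Lemma chord_ge_shock_speed u : 0 < u ->
  ze <= u / 2 + kappa / (1 - alpha) * u `^ (- alpha).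
Proof.
move=> u0; have e0 := shock_point_gt0.
have := powRN_tangent u0 e0; rewrite /shock_speed gfunE//.
have := steepnessM (lt0r_neq0 e0); rewrite steepness_shock_point.
set A := u `^ _; set B := ue `^ _ => E T.
have a1 : 0 < 1 - alpha by rewrite subr_gt0.
rewrite -(ler_pM2l a1).
have -> : (1 - alpha) * (u / 2 + kappa / (1 - alpha) * A) = (1 - alpha) * u / 2 + kappa * A.
  by field; rewrite gt_eqF.
by lra.
Qed.

(** The inverse branch stays to the right of [shock_point] because
    [g shock_point] is the critical speed; this is what makes the nonzero
    critical point of the phase a strict minimizer. *)
Lemma yplusP z : ze < z ->
  exists u, [/\ ue < u, g u = z & yplus kappa alpha z = u].
Proof.
move=> zez.
have uz : ue < z.
  apply: le_lt_trans zez; rewrite /shock_speed gfunE ?shock_point_gt0// lerDl.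
  by rewrite mulr_ge0 ?powR_ge0 ?ltW.
have z0 : 0 < z by apply: lt_trans uz; exact: shock_point_gt0.
pose h u := u + kappa * u `^ (- alpha).
have hc : {within `[ue, z], continuous h}.
  apply: derivable_within_continuous => x; rewrite in_itv/= => /andP[uex _].
  have x0 : 0 < x by apply: lt_le_trans uex; exact: shock_point_gt0.
  apply: derivableD => //; apply: derivableM => //.
  by apply: derivable_powR; rewrite in_itv/= x0.
have hz : z <= h z by rewrite lerDl mulr_ge0 ?powR_ge0 ?ltW.
have hu : h ue = ze by rewrite /shock_speed gfunE ?shock_point_gt0.
have [|u] := IVT (v := z) (ltW uz) hc.
  by rewrite ge_min le_max hu (ltW zez) hz orbT.
rewrite in_itv/= => /andP[ueu _] huz.
have u0 := lt_le_trans shock_point_gt0 ueu.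
have {}ueu : ue < u.
  by rewrite lt_neqAle ueu andbT; apply: contraTneq zez => e; rewrite -huz -e hu ltxx.
have guz : g u = z by rewrite gfunE.
exists u; split => //.
rewrite -guz /yplus pinvKV//; last first.
  by rewrite inE/= in_itv/= andbT (lt_trans y0_lt_shock_point).
move=> a b; rewrite !inE/= !in_itv/= !andbT => ya yb gab.
by have [/(gfun_increasing ya)|/(gfun_increasing yb)|//] := ltgtP a b; rewrite gab ltxx.
Qed.

Lemma potential_nondecreasing : {homo p : x y / x <= y}.
Proof.
move=> x y xy; rewrite /potential ler_wpM2l//.
  by rewrite divr_ge0 ?subr_ge0 ?ltW.
have xm : Num.max x 0 <= Num.max y 0.
  by rewrite ge_max !le_max xy lexx orbT.
by apply: ge0_ler_powR; rewrite ?subr_ge0 ?(ltW alpha_lt1) ?nnegrE ?xm // le_max lexx orbT.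
Qed.

(** The potential is nondecreasing, so to the left of [u] only the quadratic
    part of the phase can grow.  This one-sided control is enough to bound the
    mass of the weight from below. *)
Lemma phase_le_left z u e : 0 < e ->
  exists2 r, 0 < r & forall w, - r <= w - u <= 0 -> Phi z w <= Phi z u + e.
Proof.
move=> e0; pose K := `|z| + `|u| + 1.
have K0 : 0 < K by rewrite ltr_wpDl ?addr_ge0.
exists (Num.min 1 (e / K)); first by rewrite lt_min ltr01 divr_gt0.
move=> w /andP[]; rewrite lerNl le_min => /andP[w1]; rewrite ler_pdivlMr// => wK wu.
have pw : p w <= p u by apply: potential_nondecreasing; rewrite -subr_le0.
have [z1 z2] : z <= `|z| /\ - u <= `|u| by rewrite ler_norm -normrN ler_norm.
have d0 : 0 <= u - w by lra.
have : (u - w) * ((2 * (z - u) + (u - w)) / 4) <= (u - w) * K.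
  rewrite ler_wpM2l//; rewrite /K.
  by have := normr_ge0 z; have := normr_ge0 u; lra.
rewrite /phase; nra.
Qed.

(** The potential is nonnegative and vanishes at [z]. *)
Lemma phase_growth_neg z : z < 0 ->
  exists2 c, 0 < c & forall w, Phi z z + c * (w - z) ^+ 2 <= Phi z w.
Proof.
move=> z0; exists 4^-1; first by rewrite invr_gt0.
move=> w; rewrite /phase (potential_le0 (ltW z0)) subrr expr0n/= !mul0r !add0r.
have := potential_ge0 w; rewrite -sqrrN opprB; lra.
Qed.

(** For [w > 0] the difference is [w / 2] times [chord - z], where [chord] is at
    least [w / 2] and at least [z_e]: a convex combination of the two bounds
    with weight [th = 1 - z / z_e] gives [chord - z >= th * w / 2]. *)
Lemma phase_growth_small z : 0 < z -> z < ze ->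
  exists2 c, 0 < c & forall w, Phi z 0 + c * (w - 0) ^+ 2 <= Phi z w.
Proof.
move=> z0 zze; pose th := (ze - z) / ze.
have ze0 : 0 < ze by exact: lt_trans zze.
have th0 : 0 < th by rewrite divr_gt0// subr_gt0.
have thze : th * ze = ze - z by rewrite /th divfK// gt_eqF.
have th1 : th < 1 by rewrite ltr_pdivrMr// mul1r; lra.
exists (th / 4); first by rewrite divr_gt0.
move=> w; rewrite /phase (potential_le0 (lexx 0)) !subr0.
have w2 := sqr_ge0 w.
have thw2 : th * w ^+ 2 <= w ^+ 2 by rewrite ler_piMl// ltW.
have [w0|w0] := leP w 0.
  rewrite (potential_le0 w0).
  have : z * w <= 0 by rewrite mulr_ge0_le0 ?(ltW z0).
  lra.
rewrite (potential_gt0 w0).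
have := chord_ge_shock_speed w0.
rewrite (mulrCA (kappa / _)); set G := kappa / _ * _ => Gze.
have G0 : 0 <= G by rewrite mulr_ge0 ?powR_ge0 ?divr_ge0 ?subr_ge0 ?ltW.
have H : th * (w / 2) + z <= w / 2 + G.
  have : (1 - th) * ze <= (1 - th) * (w / 2 + G) by rewrite ler_wpM2l ?subr_ge0 ?(ltW th1).
  have : 0 <= th * G by rewrite mulr_ge0 ?(ltW th0).
  lra.
have : w * (th * (w / 2) + z) <= w * (w / 2 + G) by rewrite ler_wpM2l// ltW.
lra.
Qed.

(** On [w > 0], applying the tangent inequality at [u] to the factor
    [w `^ (- alpha)] of the potential leaves exactly a multiple of [(w - u)^2],
    with coefficient proportional to [(1 - alpha) / 2 - steepness u], which is
    positive since [u] lies beyond [shock_point].  For [w <= 0] the phase is the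
    parabola [(z - w)^2 / 4], and the bound, valid at 0, persists because
    [c <= 1/4] and [u < z]. *)
Lemma phase_growth_large z u : ue < u -> g u = z ->
  exists2 c, 0 < c & forall w, Phi z u + c * (w - u) ^+ 2 <= Phi z w.
Proof.
move=> ueu guz.
have a1 : 0 < 1 - alpha by rewrite subr_gt0.
have u0 := lt_trans shock_point_gt0 ueu.
have := guz; rewrite gfunE// => zE.
have A0 := powR_ge0 u (- alpha).
have quE := steepnessM (lt0r_neq0 u0).
have q0 : 0 <= q u by rewrite !mulr_ge0 ?powR_ge0 ?invr_ge0 ?ltW.
have := steepness_lt shock_point_gt0 ueu; rewrite steepness_shock_point => qlt.
have Phiu : (1 - alpha) * (2 * Phi z u) =
    (1 - alpha) * (z - u) ^+ 2 / 2 + kappa * (u * u `^ (- alpha)).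
  by rewrite /phase (potential_gt0 u0); field; rewrite gt_eqF.
pose c := ((1 - alpha) / 2 - q u) / (2 * (1 - alpha)).
have cE : (1 - alpha) * (2 * c) = (1 - alpha) / 2 - q u.
  by rewrite /c; field; rewrite gt_eqF.
have c0 : 0 < c by rewrite divr_gt0 ?mulr_gt0 ?subr_gt0.
exists c => // w.
have [w0|w0] := leP w 0.
  have c4 : c <= 4^-1.
    rewrite -(ler_pM2l a1); lra.
  (* The bound at [w = 0] is an equality. *)
  have Phi0 : Phi z u + c * u ^+ 2 = z ^+ 2 / 4.
    apply: (mulfI (lt0r_neq0 a1)).
    have : (1 - alpha) * (2 * c) * u ^+ 2 = ((1 - alpha) / 2 - q u) * u ^+ 2 by rewrite cE.
    have : q u * u * u = kappa * alpha * u `^ (- alpha) * u by rewrite quE.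
    move: Phiu; rewrite -zE; lra.
  rewrite [X in _ <= X]/phase (potential_le0 w0).
  have : 0 <= (4^-1 - c) * w ^+ 2 by rewrite mulr_ge0 ?sqr_ge0 ?subr_ge0.
  have : 0 <= - w * (z - u).
    rewrite mulr_ge0 ?oppr_ge0// -zE addrC addKr mulr_ge0// ltW//.
  have : 0 <= - w * u * (4^-1 - c).
    by rewrite !mulr_ge0 ?oppr_ge0 ?subr_ge0 ?(ltW u0).
  lra.
have Phiw : (1 - alpha) * (2 * Phi z w) =
    (1 - alpha) * (z - w) ^+ 2 / 2 + kappa * (w * w `^ (- alpha)).
  by rewrite /phase (potential_gt0 w0); field; rewrite gt_eqF.
rewrite -(ler_pM2l a1) -(@ler_pM2l _ 2)//.
have := ler_wpM2l (ltW w0) (powRN_tangent w0 u0).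
have : (1 - alpha) * (2 * c) * (w - u) ^+ 2 = ((1 - alpha) / 2 - q u) * (w - u) ^+ 2.
  by rewrite cE.
have : q u * u * (w - u) = kappa * alpha * u `^ (- alpha) * (w - u) by rewrite quE.
move: Phiw Phiu; rewrite -zE; lra.
Qed.

End phase.

(** * Growth of the primitive of the initial datum *)
Section primitive.
Variable R : realType.
Implicit Types (f h H : R -> R).

Lemma continuous_integrable_itv f (a b : R) : continuous f ->
  lebesgue_measure.-integrable `[a, b] (EFin \o f).
Proof.
move=> cf; apply: continuous_compact_integrable; first exact: segment_compact.
exact: continuous_subspaceT.
Qed.

(** A common base point [a] removes the case distinction on the sign of [y], so
    that the fundamental theorem of calculus applies near 0 as well. *)
Lemma integral0_shift f (a y : R) : continuous f -> a <= 0 -> a <= y ->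
  Defs.integral0 f y =
    \int[lebesgue_measure]_(x in `[a, y]) f x - \int[lebesgue_measure]_(x in `[a, 0]) f x.
Proof.
move=> cf a0 ay; have fi := continuous_integrable_itv _ _ cf.
have H (b c : R) : a <= b -> b <= c ->
    \int[lebesgue_measure]_(x in `[a, c]) f x - \int[lebesgue_measure]_(x in `[a, b]) f x =
    \int[lebesgue_measure]_(x in `[b, c]) f x.
  move=> ab bc; rewrite Rintegral_itvB ?bnd_simp//.
  rewrite Rintegral_itv_obnd_cbnd//.
  by apply: integrableS (fi b c) => //; exact: subset_itv_oc_cc.
rewrite /Defs.integral0; case: ifPn => [y0|]; first by rewrite H.
by rewrite -ltNge => /ltW y0; rewrite -(H y 0)// opprB.
Qed.

Lemma is_derive_integral0 f (x : R) : continuous f ->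
  is_derive x 1 (Defs.integral0 f) (f x).
Proof.
move=> cf; pose a := Num.min x 0 - 1.
have ax : a < x by rewrite /a ltrBlDr gt_min ltrDl ltr01.
have a0 : a <= 0 by rewrite /a lerBlDr ge_min add0r ler01 orbT.
pose G y := \int[lebesgue_measure]_(t in `[a, y]) f t.
have [dG G'x] : derivable G x 1 /\ derive1 G x = f x.
  apply: (@continuous_FTC1_closed _ f a x (x + 1)); rewrite ?ltrDl//.
    exact: continuous_integrable_itv.
  exact: cf.
apply: (@near_eq_is_derive _ _ _
  (fun y => G y - \int[lebesgue_measure]_(t in `[a, 0]) f t) (Defs.integral0 f) x 1 (f x)).
  near=> y; rewrite -integral0_shift// ltW//; near: y; exact: lt_nbhsr.
rewrite -[f x]subr0; apply: is_deriveB.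
by split => //; rewrite -derive1E.
Unshelve. all: by end_near. Qed.

(** Past [A] the difference [H - c / (1 - a) * y `^ (1 - a)] is nonincreasing;
    on [[0, A]] it is bounded because [H] is continuous. *)
Lemma primitive_le_powR H h (c a : R) : 0 < a -> a < 1 ->
  (forall x : R, is_derive x 1 H (h x)) ->
  (exists2 A : R, 0 < A & forall y : R, A <= y -> h y <= c * y `^ (- a)) ->
  exists C : R, forall y : R, 0 <= y -> H y <= C + c / (1 - a) * y `^ (1 - a).
Proof.
move=> a0 a1 dH [A A0 hA]; have a10 : 0 < 1 - a by rewrite subr_gt0.
have cH (b d : R) : {within `[b, d], continuous H}.
  by apply: derivable_within_continuous => x _; exact: ex_derive.
have [m _ Hm] := EVT_max (ltW A0) (cH 0 A).
pose k := c / (1 - a).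
pose C := H m + `|k| * A `^ (1 - a).
have C0 (y : R) : 0 <= y <= A -> H y <= C + k * y `^ (1 - a).
  move=> /andP[y0 yA].
  have : H y <= H m by apply: Hm; rewrite in_itv/= y0.
  have : y `^ (1 - a) <= A `^ (1 - a).
    by apply: ge0_ler_powR; rewrite ?nnegrE ?(ltW a10) ?(ltW A0).
  move=> /(ler_wpM2l (normr_ge0 k)).
  have : - k * y `^ (1 - a) <= `|k| * y `^ (1 - a).
    by rewrite ler_wpM2r ?powR_ge0// -normrN ler_norm.
  by rewrite /C; lra.
exists C => y y0; have [yA|Ay] := leP y A; first by apply: C0; rewrite y0.
pose D x := H x - k * x `^ (1 - a).
have dD (x : R) : 0 < x -> is_derive x 1 D (h x - c * x `^ (- a)).
  move=> x0; have dp := @is_derive1_powR _ (1 - a) x x0.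
  have -> : c * x `^ (- a) = k * ((1 - a) * x `^ (1 - a - 1)).
    rewrite /k mulrA divfK ?gt_eqF//; congr (_ * _ `^ _); ring.
  apply: is_deriveB.
have DA : D y <= D A.
  apply: (@ler0_derive1_le_cc _ D A y) => //; rewrite ?in_itv/= ?lexx ?(ltW Ay)//.
  - move=> x; rewrite in_itv/= => /andP[Ax _].
    by have [] := dD x (lt_trans A0 Ax).
  - move=> x; rewrite in_itv/= => /andP[Ax _].
    have [_ Dx] := dD x (lt_trans A0 Ax).
    by rewrite derive1E Dx subr_le0 hA// ltW.
  - apply: derivable_within_continuous => x; rewrite in_itv/= => /andP[Ax _].
    by have [] := dD x (lt_le_trans A0 Ax).
have := C0 A; rewrite lexx (ltW A0) => /(_ isT).
by move: DA; rewrite /D -/k; lra.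
Qed.

Lemma primitive_asymp H h (c e a : R) : 0 < a -> a < 1 ->
  (forall x : R, is_derive x 1 H (h x)) ->
  (exists2 A : R, 0 < A & forall y : R, A <= y -> `|h y - c * y `^ (- a)| <= e * y `^ (- a)) ->
  exists C : R, forall y : R, 0 <= y ->
    `|H y - c / (1 - a) * y `^ (1 - a)| <= C + e / (1 - a) * y `^ (1 - a).
Proof.
move=> a0 a1 dH [A A0 hA].
have [C1 HC1] : exists C : R, forall y : R, 0 <= y -> H y <= C + (c + e) / (1 - a) * y `^ (1 - a).
  apply: primitive_le_powR dH _ => //; exists A => // y /hA.
  by rewrite ler_norml => /andP[_]; lra.
have [C2 HC2] : exists C : R, forall y : R, 0 <= y -> - H y <= C + (e - c) / (1 - a) * y `^ (1 - a).
  apply: (@primitive_le_powR (fun y => - H y) (fun y => - h y)) => //.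
  exists A => // y /hA.
  by rewrite ler_norml => /andP[+ _]; lra.
exists (Num.max C1 C2) => y y0.
have m1 : C1 <= Num.max C1 C2 by rewrite le_max lexx.
have m2 : C2 <= Num.max C1 C2 by rewrite le_max lexx orbT.
by rewrite ler_norml; apply/andP; split; [have := HC2 y y0|have := HC1 y y0]; lra.
Qed.

End primitive.

(** * Asymptotics of the initial datum *)
Section asymptotics.
Variable R : realType.
Implicit Types (f : R -> R).

Lemma quotient_asymp_pinfty f (c a e : R) : 0 < e ->
  quotient_asymp +oo f c (fun y => `|y| `^ a) ->
  exists2 A : R, 0 < A & forall y : R, A <= y ->
    `|f y - c * y `^ (- a)| <= e * y `^ (- a).
Proof.
move=> e0 [w w0 fw]; have c1 : 0 < `|c| + 1 by rewrite ltr_wpDl.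
move/cvgrPdistC_le : w0 => /(_ _ (divr_gt0 e0 c1)) we.
have [M [_ HM]] := filterI fw we.
exists (Num.max M 0 + 1); first by rewrite ltr_wpDl// le_max lexx orbT.
move=> y My.
have [My' y0] : M < y /\ 0 < y.
  by split; apply: lt_le_trans My; rewrite ltr_pwDr// le_max lexx ?orbT.
move: (HM y My') => []; rewrite /= => ->; rewrite (gtr0_norm y0) subr0 ler_pdivlMr// => wy.
rewrite powRN mulrDr mulr1 mulrDl (addrC (c / _)) addrK normrM.
rewrite [X in _ * X <= _]ger0_norm ?invr_ge0 ?powR_ge0//.
rewrite ler_wpM2r ?invr_ge0 ?powR_ge0// normrM.
apply: le_trans wy; rewrite mulrC ler_wpM2l// lerDl//.
Qed.

(** On the left the datum decays like [`|y| `^ (- b)] with [b > a], hence is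
    negligible at the scale [`|y| `^ (- a)] that governs the right side. *)
Lemma quotient_asymp_ninfty f (c a b e : R) : 0 < e -> a < b ->
  quotient_asymp -oo f c (fun y => `|y| `^ b) ->
  exists2 A : R, 0 < A & forall y : R, A <= y ->
    `|f (- y)| <= e * y `^ (- a).
Proof.
move=> e0 ab [w w0 fw]; have d0 : 0 < b - a by rewrite subr_gt0.
move/cvgrPdistC_le : w0 => /(_ _ ltr01) we.
have [M [_ HM]] := filterI fw we.
pose B := (2 * `|c| / e) `^ (b - a)^-1.
exists (Num.max (- M) B + 1).
  by rewrite ltr_wpDl// le_max powR_ge0 orbT.
move=> y My.
have [My' By] : - M < y /\ B < y.
  by split; apply: lt_le_trans My; rewrite ltr_pwDr// le_max lexx ?orbT.
have y0 : 0 < y by apply: le_lt_trans By; exact: powR_ge0.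
have := HM (- y); rewrite ltrNl => /(_ My')[]; rewrite /= => ->.
rewrite subr0 normrN (gtr0_norm y0) => wy.
have yba : 2 * `|c| / e <= y `^ (b - a).
  have -> : 2 * `|c| / e = B `^ (b - a).
    by rewrite -powRrM mulVf ?gt_eqF// powRr1// divr_ge0 ?mulr_ge0// ltW.
  by apply: ge0_ler_powR; rewrite ?nnegrE ?powR_ge0 ?(ltW d0) ?(ltW y0) ?(ltW By).
rewrite normrM [X in _ * X <= _]ger0_norm ?invr_ge0 ?powR_ge0//.
have -> : y `^ b = y `^ (b - a) * y `^ a.
  by rewrite -powRD ?subrK// (gt_eqF y0) implybT.
rewrite powRN invfM mulrA ler_wpM2r ?invr_ge0 ?powR_ge0//.
rewrite ler_pdivrMr ?powR_gt0// normrM.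
have : `|1 + w (- y)| <= 2 by rewrite (le_trans (ler_normD _ _))// normr1; lra.
move=> /(ler_wpM2l (normr_ge0 c)).
by move: yba; rewrite ler_pdivrMr//; lra.
Qed.

Lemma integral0_potential f (kappa alpha beta e : R) :
  0 < alpha -> alpha < 1 -> alpha < beta -> continuous f ->
  quotient_asymp +oo f kappa (fun y => `|y| `^ alpha) ->
  quotient_asymp -oo f kappa (fun y => `|y| `^ beta) ->
  0 < e -> exists C : R, forall y : R,
    `|Defs.integral0 f y - potential kappa alpha y| <= C + e * `|y| `^ (1 - alpha).
Proof.
move=> a0 a1 ab cf fp fm e0.
have a10 : 0 < 1 - alpha by rewrite subr_gt0.
have e1 : 0 < e * (1 - alpha) by rewrite mulr_gt0.
have dF (x : R) := is_derive_integral0 x cf.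
have [C1 HC1] := primitive_asymp a0 a1 dF (quotient_asymp_pinfty e1 fp).
pose G (y : R) := Defs.integral0 f (- y).
have dG (x : R) : is_derive x 1 G (- f (- x)).
  have dN : is_derive x 1 (@GRing.opp R) (- 1).
    by apply: is_deriveN.
  by have := @is_derive1_comp _ _ _ _ _ _ (dF (- x)) dN; rewrite mulrN1.
have [C2 HC2] : exists C : R, forall y : R, 0 <= y ->
  `|G y - 0 / (1 - alpha) * y `^ (1 - alpha)| <=
     C + e * (1 - alpha) / (1 - alpha) * y `^ (1 - alpha).
  apply: primitive_asymp dG _ => //.
  have [A A0 HA] := quotient_asymp_ninfty e1 ab fm; exists A => // y /HA.
  by rewrite mul0r subr0 normrN.
rewrite mulfK ?gt_eqF// in HC1 HC2.
have m1 : C1 <= Num.max C1 C2 by rewrite le_max lexx.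
have m2 : C2 <= Num.max C1 C2 by rewrite le_max lexx orbT.
exists (Num.max C1 C2) => y; have [y0|y0] := leP 0 y.
  have := HC1 y y0; rewrite /potential max_l// => /le_trans; apply.
  by rewrite (ger0_norm y0) lerD2r.
have y0' : 0 <= - y by rewrite oppr_ge0 ltW.
have := HC2 (- y) y0'; rewrite /G opprK !mul0r potential_le0 ?(ltW y0)// => /le_trans; apply.
by rewrite (ltr0_norm y0) lerD2r.
Qed.

(** Locally uniform convergence would not control the tails of the weight: the
    error is measured against [1 + `|u|], which the quadratic growth of the phase
    absorbs.  The constant [C] of [integral0_potential] is swallowed by
    [s `^ (1 - alpha)], and [`|u| `^ (1 - alpha) <= 1 + `|u|]. *)
Lemma rescaled_potential f (kappa alpha beta e : R) :
  0 < alpha -> alpha < 1 -> alpha < beta -> continuous f ->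
  quotient_asymp +oo f kappa (fun y => `|y| `^ alpha) ->
  quotient_asymp -oo f kappa (fun y => `|y| `^ beta) ->
  0 < e -> exists L : R, forall s y : R, 0 < s -> L <= s `^ (1 - alpha) ->
    `|Defs.integral0 f y - s `^ (1 - alpha) * potential kappa alpha (y / s)|
       <= s `^ (1 - alpha) * (e * (1 + `|y / s|)).
Proof.
move=> a0 a1 ab cf fp fm e0.
have a10 : 0 < 1 - alpha by rewrite subr_gt0.
have e2 : 0 < e / 2 by rewrite divr_gt0.
have [C HC] := integral0_potential a0 a1 ab cf fp fm e2.
exists (2 * `|C| / e) => s y s0; rewrite ler_pdivrMr// => sL.
set l := s `^ _ in sL *; have l0 : 0 < l by exact: powR_gt0.
have -> : l * potential kappa alpha (y / s) = potential kappa alpha y.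
  rewrite /potential mulrCA -powRM ?(ltW s0) ?le_max ?lexx ?orbT//.
  rewrite maxr_pMr ?(ltW s0)// mulr0 mulrCA divff ?gt_eqF// mulr1//.
have yl : `|y| `^ (1 - alpha) <= l * (1 + `|y / s|).
  have -> : `|y| = s * `|y / s|.
    by rewrite normrM normfV (gtr0_norm s0) mulrCA divff ?gt_eqF// mulr1.
  rewrite powRM ?(ltW s0)// -/l ler_wpM2l ?(ltW l0)//.
  set v := `|y / s|; have v0 : 0 <= v := normr_ge0 _.
  have [v1|/ltW v1] := leP v 1.
    have : v `^ (1 - alpha) <= 1 `^ (1 - alpha).
      by apply: ge0_ler_powR; rewrite ?nnegrE ?(ltW a10).
    by rewrite powR1; lra.
  have : v `^ (1 - alpha) <= v by rewrite ler1_powR// lerBlDr lerDl ltW.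
  lra.
apply: le_trans (HC y) _.
have : e / 2 * `|y| `^ (1 - alpha) <= e / 2 * (l * (1 + `|y / s|)).
  by rewrite ler_wpM2l// ltW.
have : 0 <= e * l * `|y / s| by rewrite !mulr_ge0 ?(ltW e0) ?(ltW l0).
have := ler_norm C; lra.
Qed.

End asymptotics.

(** * Laplace's method *)
Section concentration.
Variables (R : realType) (s u : R).
Hypothesis s_gt0 : 0 < s.

Local Notation gauss := (fun y : R => expR (- ((y / s - u) ^+ 2 / 2))).

(** A multiple of a normal density with mean [s u] and deviation [s]: the
    integrals are taken in the original variable [y], which avoids any change of
    variables. *)
Lemma gaussE (y : R) :
  gauss y = s * Num.sqrt (2 * pi) * normal_pdf (s * u) s y.
Proof.
rewrite normal_pdfE ?gt_eqF// /normal_peak.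
have -> : s ^+ 2 * pi *+ 2 = s ^+ 2 * (2 * pi) by rewrite -mulr_natl; ring.
rewrite (sqrtrM (2 * pi) (sqr_ge0 s)) sqrtr_sqr gtr0_norm// mulrA divff ?mul1r; last first.
  by rewrite gt_eqF// mulr_gt0// sqrtr_gt0 mulr_gt0// pi_gt0.
rewrite /normal_fun; congr expR.
have -> : s ^+ 2 *+ 2 = 2 * s ^+ 2 by rewrite mulr_natl.
by field; rewrite gt_eqF.
Qed.

Lemma integrable_gauss : lebesgue_measure.-integrable setT (EFin \o gauss).
Proof.
have -> : EFin \o gauss =
    (fun y => ((s * Num.sqrt (2 * pi))%:E * (normal_pdf (s * u) s y)%:E)%E).
  by apply/funext => y; rewrite /comp gaussE.
exact: integrableZl (integrable_normal_pdf _ _).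
Qed.

Lemma integral_gauss :
  \int[lebesgue_measure]_(y in setT) gauss y = s * Num.sqrt (2 * pi).
Proof.
under eq_Rintegral do rewrite gaussE.
rewrite RintegralZl//; last exact: integrable_normal_pdf.
by rewrite /Rintegral integral_normal_pdf mulr1.
Qed.

Lemma integrable_le_gauss (f : R -> R) (M : R) : measurable_fun setT f ->
  (forall y, `|f y| <= M * gauss y) ->
  lebesgue_measure.-integrable setT (EFin \o f).
Proof.
move=> mf fM.
have iM : lebesgue_measure.-integrable setT (EFin \o (fun y => M * gauss y)).
  exact: integrableZl integrable_gauss.
apply: le_integrable iM => //; first exact/measurable_EFinP.
by move=> y _; rewrite /= lee_fin (le_trans (fM y))// ler_norm.
Qed.

(** The average of [z - y / s] differs from [z - u] by the average of
    [y / s - u].  The numerator of the latter is at most [d] times the mass of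
    [W] plus a Gaussian tail, and the mass is at least [L] times the length
    [s r] of an interval to the left of [s u].  The factor [s] cancels, so the
    bound does not depend on the scale.  The domination by [M * gauss] makes the
    integrals converge. *)
Lemma concentration (W : R -> R) (k z d K r L M : R) :
  measurable_fun setT W -> (forall y, 0 <= W y) ->
  k != 0 -> 0 <= K -> 0 < r -> 0 < L -> 0 <= d ->
  (forall y, W y <= M * gauss y) ->
  (forall y, `|y / s - u| * W y <= d * W y + K * gauss y) ->
  (forall y, - r <= y / s - u <= 0 -> L <= W y) ->
  `|k^-1 * (\int[lebesgue_measure]_(y in setT) (k * (z - y / s) * W y) /
     \int[lebesgue_measure]_(y in setT) W y) - (z - u)|
  <= d + K * Num.sqrt (2 * pi) / (r * L).
Proof.
move=> mW W0 k0 K0 r0 L0 d0 WM Wtail WL.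
have iW : lebesgue_measure.-integrable setT (EFin \o W).
  by apply: (integrable_le_gauss mW) => y; rewrite ger0_norm.
have mv : measurable_fun setT (fun y : R => y / s - u).
  by apply: measurable_funB => //; apply: measurable_funM.
have dM y : d * W y + K * gauss y <= (d * M + K) * gauss y.
  by rewrite mulrDl lerD2r -mulrA ler_wpM2l.
have ivW : lebesgue_measure.-integrable setT (EFin \o (fun y => (y / s - u) * W y)).
  apply: (@integrable_le_gauss _ (d * M + K)); first exact: measurable_funM.
  by move=> y; rewrite normrM (ger0_norm (W0 y)) (le_trans (Wtail y)).
set I := \int[lebesgue_measure]_(y in setT) W y.
pose V := \int[lebesgue_measure]_(y in setT) ((y / s - u) * W y).
have LI : s * r * L <= I.
  pose D : interval R := `[s * (u - r), s * u].
  have iD : lebesgue_measure.-integrable setT (EFin \o \1_[set` D]).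
    exact: integrable_indic_itv.
  have <- : \int[lebesgue_measure]_(y in setT) (L * \1_[set` D] y) = s * r * L.
    rewrite RintegralZl// /Rintegral integral_indic//= setIT lebesgue_measure_itv/=.
    rewrite lte_fin ltr_pM2l// gtrBl r0 /= mulrC; congr (_ * _); ring.
  apply: le_Rintegral => //; first exact: integrableZl iD.
  move=> y _; rewrite indicE; have [|] := boolP (y \in _); last by rewrite mulr0.
  rewrite inE/= in_itv/= => /andP[y1 y2]; rewrite mulr1; apply: WL.
  rewrite lerBrDr subr_le0 ler_pdivlMr// ler_pdivrMr// addrC !(mulrC _ s) y1.
  exact: y2.
have I0 : 0 < I by apply: lt_le_trans LI; rewrite !mulr_gt0.
have VI : `|V| <= d * I + K * (s * Num.sqrt (2 * pi)).
  apply: le_trans (le_normr_Rintegral _ ivW) _ => //.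
  rewrite -integral_gauss -!RintegralZl//; last exact: integrable_gauss.
  rewrite -RintegralD//; first last.
  - exact: integrableZl integrable_gauss.
  - exact: integrableZl iW.
  apply: le_Rintegral => //.
  - exact: integrable_norm ivW.
  - apply: (@integrable_le_gauss _ (d * M + K)).
      apply: measurable_funD; apply: measurable_funM => //.
      by move/integrableP : integrable_gauss => [/measurable_EFinP].
    move=> y; rewrite ger0_norm; first exact: dM.
    by rewrite addr_ge0 ?mulr_ge0 ?expR_ge0.
  - by move=> y _; rewrite normrM (ger0_norm (W0 y)).
have -> : \int[lebesgue_measure]_(y in setT) (k * (z - y / s) * W y) =
    k * ((z - u) * I - V).
  rewrite -[in RHS]RintegralZl// -RintegralB//; last exact: integrableZl iW.
  rewrite -RintegralZl//; last first.
    by exact: (integrableB _ (integrableZl _ _ iW) ivW).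
  by apply: eq_Rintegral => y _; ring.
have -> : k^-1 * (k * ((z - u) * I - V) / I) - (z - u) = - (V / I).
  by field; rewrite k0 gt_eqF.
rewrite normrN normrM normfV (gtr0_norm I0) ler_pdivrMr//.
have C0 : 0 <= K * Num.sqrt (2 * pi) / (r * L).
  by rewrite divr_ge0 ?mulr_ge0 ?sqrtr_ge0 ?(ltW r0) ?(ltW L0).
have := ler_wpM2l C0 LI.
have -> : K * Num.sqrt (2 * pi) / (r * L) * (s * r * L) = K * (s * Num.sqrt (2 * pi)).
  by field; rewrite !gt_eqF.
by move: VI; lra.
Qed.

End concentration.

(** With [v = y / s - u], the perturbed exponent [E] is at least
    [l (Phi u - e + c / 2 * v^2)] everywhere and at most [l (Phi u + 2 e)] on a
    fixed interval to the left of [u].  The ratio of the contribution of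
    [`|v| > d] to the total mass is then of order
    [expR (3 l e - l c d^2 / 2)], which tends to 0 for [e = c d^2 / 12]. *)
Lemma laplace_concentration (R : realType) (Phi : R -> R) (z u c d : R) :
  0 < c -> 0 < d -> (forall w, Phi u + c * (w - u) ^+ 2 <= Phi w) ->
  (forall e, 0 < e ->
    exists2 r, 0 < r & forall w, - r <= w - u <= 0 -> Phi w <= Phi u + e) ->
  exists2 eta : R, 0 < eta & exists Lam : R,
  forall (s l k : R) (E : R -> R), 0 < s -> Lam <= l -> k != 0 ->
    measurable_fun setT E ->
    (forall y, `|E y - l * Phi (y / s)| <= l * (eta * (1 + `|y / s|))) ->
  `|k^-1 * (\int[lebesgue_measure]_(y in setT) (k * (z - y / s) * expR (- E y)) /
     \int[lebesgue_measure]_(y in setT) expR (- E y)) - (z - u)| <= 2 * d.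
Proof.
move=> c0 d0 growth left.
pose e := c * d ^+ 2 / 12.
have e0 : 0 < e by rewrite divr_gt0 ?mulr_gt0 ?exprn_gt0.
have [r0 r0_gt0 Hr0] := left e e0.
pose r := Num.min r0 1.
have r_gt0 : 0 < r by rewrite lt_min r0_gt0 ltr01.
(* [A] is such that [1 + `|u + v| <= A - 1 + v^2], and [<= A] when [`|v| <= 1]. *)
pose A := 3 + `|u|.
have A0 : 0 < A by have := normr_ge0 u; rewrite /A; lra.
pose eta := Num.min (e / A) (c / 2).
have eta0 : 0 < eta.
  by rewrite lt_min (divr_gt0 e0 A0) divr_gt0.
have etaA : eta * A <= e by rewrite -ler_pdivlMr// ge_min lexx.
have etac : eta <= c / 2 by rewrite ge_min lexx orbT.
pose B := 2 / d * expR (d ^+ 2) * Num.sqrt (2 * pi) / r.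
exists eta => //.
(* The first threshold makes the surplus [l c / 2 * v^2] of the exponent at
   least [v^2]; the second makes the final tail bound at most [d]. *)
exists (Num.max (2 / c) (B / (d * (c * d ^+ 2 / 4)))).
move=> s l k E s0 + k0 mE HE.
rewrite ge_max ler_pdivrMr// ler_pdivrMr ?mulr_gt0 ?divr_gt0 ?exprn_gt0//.
move=> /andP[lc lB].
have l0 : 0 < l by rewrite -(pmulr_lgt0 _ c0); lra.
have weight y : 1 + `|y / s| <= A - 1 + (y / s - u) ^+ 2.
  have -> : y / s = (y / s - u) + u by rewrite subrK.
  rewrite addrK; set v := y / s - u.
  have : `|v| <= 1 + v ^+ 2 by rewrite -real_normK ?num_real//; have := sqr_ge0 (`|v| - 1); nra.
  by have := ler_normD v u; rewrite /A; lra.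
have Elo y : l * Phi u - l * e + l * c / 2 * (y / s - u) ^+ 2 <= E y.
  have := HE y; rewrite ler_norml => /andP[+ _].
  have := ler_wpM2l (ltW l0) (growth (y / s)).
  have : l * (eta * (1 + `|y / s|)) <= l * (eta * A + eta * (y / s - u) ^+ 2).
    rewrite ler_wpM2l ?(ltW l0)// -mulrDr ler_wpM2l ?(ltW eta0)//.
    by have := weight y; lra.
  have : l * (eta * A + eta * (y / s - u) ^+ 2) <= l * (e + c / 2 * (y / s - u) ^+ 2).
    by rewrite ler_wpM2l ?(ltW l0)// lerD// ler_wpM2r ?sqr_ge0.
  by lra.
have Ehi y : - r <= y / s - u <= 0 -> E y <= l * Phi u + 2 * l * e.
  move=> /andP[ry y0]; have := HE y; rewrite ler_norml => /andP[_].
  have rr : r <= r0 /\ r <= 1 by rewrite /r !ge_min !lexx orbT.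
  have Py : Phi (y / s) <= Phi u + e by apply: Hr0; rewrite y0 andbT; lra.
  have := ler_wpM2l (ltW l0) Py.
  have v1 : (y / s - u) ^+ 2 <= 1 by nra.
  have : l * (eta * (1 + `|y / s|)) <= l * (eta * A).
    rewrite ler_wpM2l ?(ltW l0)// ler_wpM2l ?(ltW eta0)//.
    by have := weight y; lra.
  have := ler_wpM2l (ltW l0) etaA.
  by lra.
pose L := expR (- (l * Phi u + 2 * l * e)).
pose K := 2 / d * expR (- l * Phi u + l * e - (l * c / 2 - 1) * d ^+ 2).
pose M := expR (- l * Phi u + l * e).
have := @concentration R s u s0 (fun y => expR (- E y)) k z d K r L M.
have KL : K * Num.sqrt (2 * pi) / (r * L) <= d.
  have KE : K = 2 / d * expR (d ^+ 2) * (expR (- (l * (c * d ^+ 2 / 4))) * L).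
    by rewrite /K /L -!mulrA -!expRD; congr (_ * (_ * expR _)); rewrite /e; field.
  have -> : K * Num.sqrt (2 * pi) / (r * L) = B * expR (- (l * (c * d ^+ 2 / 4))).
    by rewrite KE /B; field; rewrite !gt_eqF ?expR_gt0.
  rewrite expRN ler_pdivrMr ?expR_gt0//.
  set x := l * _.
  have : d * x <= d * expR x.
    by rewrite ler_wpM2l ?(ltW d0)//; have := expR_ge1Dx x; lra.
  apply: le_trans; move: lB; rewrite /x; lra.
move=> H; apply: le_trans (H _ _ _ _ _ _ _ _ _ _) _ => //.
- by apply: measurableT_comp => //; exact: measurable_funN.
- by rewrite mulr_ge0 ?expR_ge0// divr_ge0 ?(ltW d0).
- exact: expR_gt0.
- exact: ltW.
- move=> y; rewrite -expRD ler_expR.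
  have : 0 <= (l * c - 2) * (y / s - u) ^+ 2 by rewrite mulr_ge0 ?sqr_ge0 ?subr_ge0.
  by have := Elo y; have := sqr_ge0 (y / s - u); lra.
- move=> y; set v := y / s - u.
  have [vd|dv] := leP `|v| d.
    rewrite (@le_trans _ _ (d * expR (- E y)))// ?ler_wpM2r ?expR_ge0//.
    by rewrite lerDl !mulr_ge0 ?expR_ge0 ?invr_ge0 ?(ltW d0).
  rewrite (@le_trans _ _ (K * expR (- (v ^+ 2 / 2))))//; last first.
    by rewrite lerDr mulr_ge0 ?expR_ge0 ?(ltW d0).
  (* A factor [expR (v^2 / 2)] pays for the weight [`|v|], and another one for
     leaving a Gaussian in the bound. *)
  have vv : `|v| <= 2 / d * expR (v ^+ 2 / 2).
    have -> : 2 / d * expR (v ^+ 2 / 2) = 2 * expR (v ^+ 2 / 2) / d by rewrite mulrAC.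
    rewrite ler_pdivlMr//.
    have : `|v| * d <= `|v| * `|v| by rewrite ler_wpM2l// ltW.
    rewrite -expr2 real_normK ?num_real//.
    by have := expR_ge1Dx (v ^+ 2 / 2); lra.
  rewrite (le_trans (ler_wpM2r (expR_ge0 _) vv))// /K -!mulrA -!expRD.
  rewrite ler_wpM2l ?(ltW d0)// ler_wpM2l ?invr_ge0 ?(ltW d0)// ler_expR.
  have dv2 : d ^+ 2 <= v ^+ 2.
    by rewrite -[leRHS]real_normK ?num_real// ler_sqr ?nnegrE ?(ltW d0) ?(ltW dv).
  have : 0 <= (l * c / 2 - 1) * (v ^+ 2 - d ^+ 2).
    by rewrite mulr_ge0 ?subr_ge0//; lra.
  by have := Elo y; rewrite -/v; lra.
- by move=> y /Ehi; rewrite ler_expR lerN2.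
- by move: KL; lra.
Qed.

Lemma powR_ge_near (R : realType) (p B : R) : 0 < p ->
  \forall t \near +oo, B <= t `^ p.
Proof.
move=> p0; exists (Num.max B 0 `^ p^-1); split; first exact: num_real.
move=> t Bt; have B0 : 0 <= Num.max B 0 by rewrite le_max lexx orbT.
have : (Num.max B 0 `^ p^-1) `^ p <= t `^ p.
  apply: ge0_ler_powR; rewrite ?nnegrE ?powR_ge0 ?(ltW p0) ?(ltW Bt)//.
  by rewrite (le_trans _ (ltW Bt))// powR_ge0.
rewrite -powRrM mulVf ?gt_eqF// powRr1//; apply: le_trans.
by rewrite le_max lexx.
Qed.

(** The Hopf-Cole formula in the self-similar scaling: [l = s^2 / t] is the
    large parameter, and [(x - y) / t] is [z - y / s] up to the factor
    [s `^ (- alpha)] that the prefactor of the solution compensates. *)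
Lemma burgers_limit (R : realType) (kappa alpha beta z u c : R) (f0 : R -> R) :
  0 < kappa -> 0 < alpha -> alpha < 1 -> alpha < beta -> continuous f0 ->
  quotient_asymp +oo f0 kappa (fun y => `|y| `^ alpha) ->
  quotient_asymp -oo f0 kappa (fun y => `|y| `^ beta) ->
  0 < c ->
  (forall w, phase kappa alpha z u + c * (w - u) ^+ 2 <= phase kappa alpha z w) ->
  t `^ (alpha / (1 + alpha)) *
    burgers_solution f0 (z * t `^ (1 + alpha)^-1) t @[t --> +oo] --> z - u.
Proof.
move=> k0 a0 a1 ab cf fp fm c0 growth.
have a10 : 0 < 1 - alpha by rewrite subr_gt0.
have a11 : 0 < 1 + alpha by rewrite addr_gt0.
apply/cvgrPdistC_le => e e0.
have e2 : 0 < e / 2 by rewrite divr_gt0.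
have [eta eta0 [Lam HLam]] := laplace_concentration z c0 e2 growth
  (fun e' => @phase_le_left R kappa alpha k0 a1 z u e').
have eta2 : 0 < 2 * eta by rewrite mulr_gt0.
have [L HL] := rescaled_potential a0 a1 ab cf fp fm eta2.
have pos : 0 < (1 + alpha)^-1 * (1 - alpha) by rewrite mulr_gt0 ?invr_gt0.
near=> t.
have t0 : 0 < t by near: t; exact: nbhs_pinfty_gt.
pose s := t `^ (1 + alpha)^-1.
have s0 : 0 < s by exact: powR_gt0.
have sl : Num.max L Lam <= s `^ (1 - alpha).
  by rewrite -powRrM; near: t; exact: powR_ge_near.
move: sl; rewrite ge_max => /andP[Ls Lams].
have sa : s `^ alpha = t `^ (alpha / (1 + alpha)) by rewrite -powRrM mulrC.
have sa0 : 0 < s `^ alpha by exact: powR_gt0.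
have tE : t = s * s `^ alpha.
  rewrite -[X in X * _]powRr1 ?(ltW s0)// -powRD ?(gt_eqF s0) ?implybT//.
  by rewrite -powRrM mulVf ?gt_eqF// powRr1 ?ltW.
have lE : s `^ (1 - alpha) = s / s `^ alpha.
  by rewrite powRB ?(gt_eqF s0) ?implybT// powRr1 ?ltW.
pose E y := (z * s - y) ^+ 2 / (4 * t) + 2^-1 * Defs.integral0 f0 y.
have wE y : hopf_cole_weight f0 (z * s) t y = expR (- E y).
  by rewrite /hopf_cole_weight /E opprD.
have mE : measurable_fun setT E.
  apply: continuous_measurable_fun => y.
  apply: differentiable_continuous; apply/derivable1_diffP.
  have dF := is_derive_integral0 y cf.
  by apply: derivableD.
have := HLam s (s `^ (1 - alpha)) (s `^ alpha)^-1 E s0 Lams _ mE.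
rewrite invr_eq0 gt_eqF// invrK => /(_ isT) H.
rewrite -sa /burgers_solution -/s.
have -> : (fun y => (z * s - y) / t * hopf_cole_weight f0 (z * s) t y) =
    (fun y => (s `^ alpha)^-1 * (z - y / s) * expR (- E y)).
  apply/funext => y; rewrite wE tE; congr (_ * _).
  by field; rewrite !gt_eqF.
have -> : hopf_cole_weight f0 (z * s) t = (fun y => expR (- E y)) by apply/funext.
have -> : e = 2 * (e / 2) by rewrite mulrCA divff ?mulr1.
apply: H => y.
have {}HL := HL s y s0 Ls.
have -> : E y - s `^ (1 - alpha) * phase kappa alpha z (y / s) =
    2^-1 * (Defs.integral0 f0 y - s `^ (1 - alpha) * potential kappa alpha (y / s)).
  by rewrite /E /phase tE lE; field; rewrite !gt_eqF.
by rewrite (normrM 2^-1) (ger0_norm (x := 2^-1)) ?invr_ge0//; lra.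
Unshelve. all: by end_near. Qed.

Unset Implicit Arguments.

Theorem proposition1p9 (R : realType) (kappa alpha : R)
    (kappa_gt0 : 0 < kappa) (alpha_gt0 : 0 < alpha) (alpha_lt1 : alpha < 1) :
  exists z_e : R,
    0 < z_e /\ gfun kappa alpha (y0 kappa alpha) <= z_e /\
    forall (beta : R) (f0 : R -> R),
      alpha < beta -> beta < 1 ->
      (forall y : R, derivable f0 y 1) -> continuous (derive1 f0) ->
      quotient_asymp +oo f0 kappa (fun y => `|y| `^ alpha) ->
      quotient_asymp -oo f0 kappa (fun y => `|y| `^ beta) ->
      quotient_asymp +oo (derive1 f0) (- alpha * kappa)
        (fun y => y * `|y| `^ alpha) ->
      quotient_asymp -oo (derive1 f0) (- beta * kappa)
        (fun y => y * `|y| `^ beta) ->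
      (forall y : R, 0 < f0 y) ->
      (forall y : R, y < 0 -> 0 < derive1 f0 y) ->
      (forall y : R, 0 < y -> derive1 f0 y < 0) ->
      forall z : R, z != 0 -> z != z_e ->
        t `^ (alpha / (1 + alpha)) *
          burgers_solution f0 (z * t `^ (1 + alpha)^-1) t
          @[t --> +oo] --> profile kappa alpha z_e z.
Proof.
exists (shock_speed kappa alpha).
split; first exact: shock_speed_gt0.
split; first by apply: gfun_min => //; exact: shock_point_gt0.
move=> beta f0 ab _ df _ fp fm _ _ _ _ _ z z0 zze.
have cf : continuous f0.
  by move=> y; apply: differentiable_continuous; apply/derivable1_diffP.
rewrite /profile; case: ifPn => [zgt|].
  have [u [ueu guz ->]] := yplusP kappa_gt0 alpha_gt0 alpha_lt1 zgt.
  have [c c0 growth] := phase_growth_large kappa_gt0 alpha_gt0 alpha_lt1 ueu guz.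
  have u0 : 0 < u by exact: lt_trans (shock_point_gt0 kappa_gt0 alpha_gt0 alpha_lt1) ueu.
  have -> : kappa * `|u| `^ (- alpha) = z - u.
    by rewrite gtr0_norm// -guz gfunE//; ring.
  exact: (burgers_limit kappa_gt0 alpha_gt0 alpha_lt1 ab cf fp fm c0 growth).
rewrite -leNgt le_eqVlt (negPf zze) /= => zlt; case: ifPn => [zgt0|].
  have [c c0 growth] := phase_growth_small kappa_gt0 alpha_gt0 alpha_lt1 zgt0 zlt.
  by have := burgers_limit kappa_gt0 alpha_gt0 alpha_lt1 ab cf fp fm c0 growth; rewrite subr0.
rewrite -leNgt le_eqVlt (negPf z0) /= => zlt0.
have [c c0 growth] := phase_growth_neg kappa_gt0 alpha_lt1 zlt0.
by have := burgers_limit kappa_gt0 alpha_gt0 alpha_lt1 ab cf fp fm c0 growth; rewrite subrr.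
Qed.
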